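(* Let $1\le p\le\infty$ and $0<q\le\infty$. Let $U$ be a regular kernel on $\mathbb Z\times\mathbb Z$ and let $\{v_n\}_{n\in\mathbb Z},\{w_n\}_{n\in\mathbb Z}$ be sequences of nonnegative real numbers. Extend $U$ to $\mathbb R^2$ by $U(s,t)=\sum_{(i,n)\in\mathbb Z^2}U(i,n)\chi_{(i-1,i]\times(n-1,n]}(s,t)$ and put $v(t)=\sum_{n\in\mathbb Z}v_n\chi_{(n-1,n]}(t)$, $w(t)=\sum_{n\in\mathbb Z}w_n\chi_{(n-1,n]}(t)$ for $s,t\in\mathbb R$. Then there is a constant $C$ such that $$\Big(\sum_{n\in\mathbb Z}w_n\Big[\sup_{-\infty<i\le n}U(i,n)\sum_{j=-\infty}^ia_j\Big]^q\Big)^{1/q}\le C\Big(\sum_{n\in\mathbb Z}a_n^pv_n\Big)^{1/p}$$ for every sequence $\{a_n\}_{n\in\mathbb Z}$ of nonnegative real numbers if and only if there is a constant $C_1$ such that $$\Big(\int_{-\infty}^\infty\Big(\operatorname*{ess\,sup}_{-\infty<y\le x}U(y,x)\int_{-\infty}^yf(t)\,dt\Big)^qw(x)\,dx\Big)^{1/q}\le C_1\Big(\int_{-\infty}^\infty f(t)^pv(t)\,dt\Big)^{1/p}$$ for every nonnegative measurable function $f$ on $\mathbb R$. Moreover, if $C$ and $C_1$ are the best constants, then $C\approx C_1$.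
   Context: A function $U\colon\mathbb Z\times\mathbb Z\to[0,\infty)$ is a regular kernel if it is nonincreasing in the first variable, nondecreasing in the second variable, and there is a positive constant $c$ (the constant of regularity) with $U(i,n)\le c(U(i,j)+U(j,n))$ for all integers $i\le j\le n$. $A\approx B$ means $c_1A\le B\le c_2A$ with positive constants $c_1,c_2$ depending only on $p$, $q$ and the constant of regularity of $U$. Sums and integrals take values in $[0,\infty]$, with $0\cdot\infty=0$. When $q=\infty$, the left-hand sides are replaced by $\sup_nw_n\sup_{i\le n}U(i,n)\sum_{j\le i}a_j$ and $\operatorname{ess\,sup}_xw(x)\operatorname{ess\,sup}_{y\le x}U(y,x)\int_{-\infty}^yf$. When $p=\infty$, the right-hand sides are replaced by $C\sup_na_nv_n$ and $C_1\operatorname{ess\,sup}_tf(t)v(t)$. *)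

(* Defs.v *)
From HB Require Import structures.
From mathcomp Require Import all_boot all_order all_algebra.
From mathcomp Require Import all_classical all_reals all_analysis.
From mathcomp Require Import ess_sup_inf.

Set Implicit Arguments.
Unset Strict Implicit.
Unset Printing Implicit Defensive.

Import Order.TTheory GRing.Theory Num.Theory.
Import numFieldNormedType.Exports.

Local Open Scope classical_set_scope.
Local Open Scope ring_scope.

Record regular_kernel (R : realType) (c : R) (U : int -> int -> R) : Prop := {
  regular_kernel_cst_gt0 : 0 < c ;
  regular_kernel_ge0 : forall i n, 0 <= U i n ;
  regular_kernel_nonincreasing : forall i j n, i <= j -> U j n <= U i n ;
  regular_kernel_nondecreasing : forall i j n, j <= n -> U i j <= U i n ;
  regular_kernel_triangle : forall i j n, i <= j -> j <= n ->
    U i n <= c * (U i j + U j n) }.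

Definition unit_itv (R : realType) (n : int) : set R :=
  `](n%:~R - 1), n%:~R]%classic.

(* In the two extensions below at most one term of the finite-support sum is
   nonzero at any given point. *)
Definition step_kernel (R : realType) (U : int -> int -> R) (s t : R) : R :=
  \sum_(k \in [set: int * int])
    U k.1 k.2 * \1_(unit_itv k.1 `*` unit_itv k.2) (s, t).

Definition step_fun (R : realType) (v : int -> R) (t : R) : R :=
  \sum_(n \in [set: int]) v n * \1_(unit_itv n) t.

Local Open Scope ereal_scope.

(* For a finite exponent the weight multiplies the r-th power, so it acts like
   a density; for the exponent +oo it multiplies the argument itself. The
   exponent -oo is never used. *)
Definition wnorm_seq (R : realType) (r : \bar R) (v : int -> R)
    (a : int -> \bar R) : \bar R :=
  match r with
  | s%:E => (\esum_(n in [set: int]) (v n)%:E * a n `^ s) `^ s^-1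
  | +oo => ereal_sup [set (v n)%:E * a n | n in [set: int]]
  | -oo => 0
  end.

Definition wnorm_fun (R : realType) (r : \bar R) (v : R -> R)
    (f : R -> \bar R) : \bar R :=
  match r with
  | s%:E => (\int[lebesgue_measure]_x ((v x)%:E * f x `^ s)) `^ s^-1
  | +oo => ess_sup lebesgue_measure (fun x => (v x)%:E * f x)
  | -oo => 0
  end.

Definition sup_op_seq (R : realType) (U : int -> int -> R) (a : int -> R)
    (n : int) : \bar R :=
  ereal_sup [set (U i n)%:E * \esum_(j in [set j : int | (j <= i)%R]) (a j)%:E
            | i in [set i : int | (i <= n)%R]].

(* The essential supremum over y <= x is the one for the Lebesgue measure
   restricted to ]-oo, x]. *)
Definition sup_op_fun (R : realType) (U : R -> R -> R) (f : R -> R)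
    (x : R) : \bar R :=
  ess_sup
    (mrestr lebesgue_measure (measurable_itv `]-oo, x] : measurable `]-oo, x]))
    (fun y => (U y x)%:E * \int[lebesgue_measure]_(t in `]-oo, y]) (f t)%:E).

Definition discrete_ineq (R : realType) (p q : \bar R) (U : int -> int -> R)
    (v w : int -> R) (C : R) : Prop :=
  forall a : int -> R, (forall n, 0 <= a n)%R ->
    wnorm_seq q w (sup_op_seq U a) <= C%:E * wnorm_seq p v (EFin \o a).

Definition continuous_ineq (R : realType) (p q : \bar R) (U : R -> R -> R)
    (v w : R -> R) (C : R) : Prop :=
  forall f : R -> R, measurable_fun setT f -> (forall x, 0 <= f x)%R ->
    wnorm_fun q w (sup_op_fun U f) <= C%:E * wnorm_fun p v (EFin \o f).

(* Equals +oo when no constant is admissible. *)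
Definition best_constant (R : realType) (ineq : R -> Prop) : \bar R :=
  ereal_inf [set C%:E | C in [set C : R | (0 <= C)%R /\ ineq C]].

(* Main.v *)
Require Import Defs.
From HB Require Import structures.
From mathcomp Require Import all_boot all_order all_algebra.
From mathcomp Require Import all_classical all_reals all_analysis.
From mathcomp Require Import measurable_realfun ess_sup_inf ring lra.

Set Implicit Arguments.
Unset Strict Implicit.
Unset Printing Implicit Defensive.

Import Order.TTheory GRing.Theory Num.Theory.
Import numFieldNormedType.Exports.

Local Open Scope classical_set_scope.
Local Open Scope ring_scope.

(** The two inequalities are compared by passing between sequences and
    functions on the unit intervals (n - 1, n].

    From discrete to continuous, with the same constant
    ([continuous_ineq_of_discrete]). Given f, let a_n be its integral over
    (n - 1, n]. If y <= x lie in the unit intervals of i <= n, then the integral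
    of f up to y is at most the sum of the a_j with j <= i, so the operator
    applied to f is bounded on (n - 1, n] by the discrete operator applied to a
    ([sup_op_fun_le]), while Jensen's inequality on each unit interval bounds
    the norm of a by that of f ([wnorm_seq_mean_le]). The discrete inequality
    only speaks of sequences with finite entries, whereas a_m may be infinite
    even when the right-hand side is finite. In that case the discrete
    inequality holds, with a bounded right-hand side, for all multiples of the
    sequence supported at m; this forces U(m, n) = 0 for every n >= m with w_n
    nonzero ([discrete_ineq_kernel0]). By monotonicity of U all terms seeing an
    infinite entry then vanish, and the infinite entries can be replaced by
    zero.

    From continuous to discrete ([discrete_ineq_of_continuous]). Given a, the
    continuous inequality is applied to the step function f with values 2 a_n.
    For y in the right half (i - 1/2, i] of a unit interval, the integral of f
    up to y is at least the sum of the a_j with j <= i, because the left half of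
    each interval already carries the mass a_j. Hence on the right half of
    (n - 1, n] the continuous operator dominates the discrete one
    ([sup_op_seq_le_fun]). Losing half of each interval costs a factor 2^(1/q)
    for finite q and nothing for q = +oo, and the factor 2 in f costs 2 on the
    right-hand side. *)

(** * Unit intervals and step functions *)

Section unit_partition.
Context {R : realType}.
Implicit Types (n : int) (x y : R).
Local Notation mu := (@lebesgue_measure R).

Lemma unit_itvE n x : unit_itv n x <-> Num.ceil x = n.
Proof.
rewrite /unit_itv /= in_itv /=; split=> [h|<-].
  by apply: ceil_def; rewrite intrB.
by have := ceil_itv x; rewrite intrB.
Qed.

Lemma step_funE (v : int -> R) x : step_fun v x = v (Num.ceil x).
Proof.
rewrite /step_fun -(fsbig_widen [set Num.ceil x]) //= ?fsbig_set1.
  by rewrite indicE mem_set ?mulr1//; exact/unit_itvE.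
move=> n [_ /= nx]; rewrite indicE memNset ?mulr0// => /unit_itvE/esym.
exact: nx.
Qed.

Lemma step_kernelE (U : int -> int -> R) x y :
  step_kernel U x y = U (Num.ceil x) (Num.ceil y).
Proof.
rewrite /step_kernel -(fsbig_widen [set (Num.ceil x, Num.ceil y)]) //=.
  by rewrite fsbig_set1 indicE mem_set ?mulr1//; split; exact/unit_itvE.
move=> [i n] [_ /= inx]; rewrite indicE memNset ?mulr0// => -[/=].
by move=> /unit_itvE ix /unit_itvE ny; apply: inx; rewrite ix ny.
Qed.

Lemma measurable_unit_itv n : measurable (unit_itv n : set R).
Proof. exact: measurable_itv. Qed.

Lemma lebesgue_measure_unit_itv n : mu (unit_itv n) = 1%E.
Proof.
rewrite lebesgue_measure_itv /= lte_fin ltrBlDr ltrDl ltr01 -EFinB.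
by rewrite opprB addrCA subrr addr0.
Qed.

Definition half_itv n : set R := `](n%:~R - 2^-1), n%:~R]%classic.

Lemma half_itv_unit n : half_itv n `<=` unit_itv n.
Proof.
move=> x; rewrite /half_itv /unit_itv /= !in_itv /= => /andP[nx ->].
by rewrite andbT (le_lt_trans _ nx)// lerD2l lerN2 invf_le1// ler1n.
Qed.

Lemma measurable_half_itv n : measurable (half_itv n).
Proof. exact: measurable_itv. Qed.

Lemma lebesgue_measure_half_itv n : mu (half_itv n) = (2^-1)%:E.
Proof.
rewrite lebesgue_measure_itv /= lte_fin ltrBlDr ltrDl invr_gt0 ltr0n -EFinB.
by rewrite opprB addrCA subrr addr0.
Qed.

(** Alternates between the nonnegative and the negative integers, so that
    results on sums and unions over nat apply to families indexed by int. *)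
Definition int_of_nat (k : nat) : int := if odd k then Negz k./2 else Posz k./2.

Lemma int_of_nat_bij : set_bij [set: nat] [set: int] int_of_nat.
Proof.
split=> //.
- move=> a b _ _; rewrite /int_of_nat.
  case oa: (odd a); case ob: (odd b) => // -[ab];
  by rewrite -(odd_double_half a) -(odd_double_half b) oa ob ab.
- move=> [n|n] _.
  + by exists n.*2 => //; rewrite /int_of_nat odd_double doubleK.
  + by exists n.*2.+1 => //; rewrite /int_of_nat /= odd_double /= uphalf_double.
Qed.

Lemma bigcup_unit_itv : \bigcup_k (unit_itv (int_of_nat k) : set R) = setT.
Proof.
apply/seteqP; split=> // x _.
have [_ _ /(_ (Num.ceil x) I)[k _ kx]] := int_of_nat_bij.
by exists k => //; rewrite kx; exact/unit_itvE.
Qed.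

Local Open Scope ereal_scope.

(** Reduces integrals over a half line or the whole line to sums over int; the
    extra domain [D] covers half lines ending inside a unit interval. *)
Lemma ge0_integral_unit_itv (D : set R) (f : R -> \bar R) :
  measurable D -> measurable_fun D f -> (forall x, D x -> 0 <= f x) ->
  \int[mu]_(x in D) f x =
  \esum_(n in [set: int]) \int[mu]_(x in D `&` unit_itv n) f x.
Proof.
move=> mD mf f0.
have DE : \bigcup_k (D `&` unit_itv (int_of_nat k)) = D.
  by rewrite -setI_bigcupr bigcup_unit_itv setIT.
rewrite -{1}DE ge0_integral_bigcup//=; last 4 first.
- by move=> k; apply: measurableI => //; exact: measurable_unit_itv.
- by rewrite DE.
- by rewrite DE.
- move=> a b _ _ [x [[_ /unit_itvE xa] [_ /unit_itvE xb]]].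
  by have [_ inj _] := int_of_nat_bij; apply: inj; rewrite ?inE// -xa -xb.
rewrite nneseries_esumT//; last by move=> k; apply: integral_ge0 => x [/f0].
by rewrite (@reindex_esum R _ _ _ _ _ _ int_of_nat_bij).
Qed.

Lemma measurable_fun_unit_itv d (T : measurableType d) (f : R -> T) :
  (forall n, measurable_fun (unit_itv n) f) -> measurable_fun setT f.
Proof.
move=> mf; rewrite -bigcup_unit_itv; apply/measurable_fun_bigcup => k //.
exact: measurable_unit_itv.
Qed.

End unit_partition.

(** * Integrals of step functions, and two inequalities on integrals *)

(** The integral of a nonnegative function is defined as a supremum over the
    simple functions below it, hence is monotone on all functions, measurable or
    not. It is in this form that the supremum operator is compared with step
    functions. *)
Lemma ge0_le_integralT d (T : measurableType d) (R : realType)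
    (m : {measure set T -> \bar R}) (f g : T -> \bar R) :
  (forall x, 0 <= f x)%E -> (forall x, f x <= g x)%E ->
  (\int[m]_x f x <= \int[m]_x g x)%E.
Proof.
move=> f0 fg; rewrite !ge0_integralTE//; last first.
  by move=> x; exact: le_trans (fg x).
by apply: ereal_sup_le => _ [h hf <-]; exists h => // x; exact: le_trans (fg x).
Qed.

Section integral_step.
Context {R : realType}.
Implicit Types (n : int) (x y : R).
Local Notation mu := (@lebesgue_measure R).
Local Open Scope ereal_scope.

(** Restricting each value to a subset of its unit interval treats at once the
    full unit intervals and their right halves. *)
Lemma integral_step (A : int -> set R) (G : int -> \bar R) :
  (forall n, measurable (A n)) -> (forall n, A n `<=` unit_itv n) ->
  (forall n, 0 <= G n) ->
  \int[mu]_x (if x \in A (Num.ceil x) then G (Num.ceil x) else 0) =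
  \esum_(n in [set: int]) (G n * mu (A n)).
Proof.
move=> mA AU G0; set h := (fun x : R => if _ then _ else _).
have hE n : {in unit_itv n, (cst (G n)) \_ (A n) =1 h}.
  by move=> x /set_mem/unit_itvE xn; rewrite /h patchE xn.
have h0 x : 0 <= h x by rewrite /h; case: ifP.
rewrite ge0_integral_unit_itv//; last 2 first.
- apply: measurable_fun_unit_itv => n; apply: eq_measurable_fun (hE n) _.
  by apply/measurable_restrict => //; exact: measurable_unit_itv.
- by move=> x _; exact: h0.
apply: eq_esum => n _; rewrite setTI.
transitivity (\int[mu]_(x in unit_itv n) ((cst (G n)) \_ (A n)) x).
  by apply: eq_integral => x xn; rewrite hE.
rewrite -integral_mkcondr setIidr; last exact: AU.
by rewrite integral_cst; last exact: mA.
Qed.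

Lemma integral_step_unit (G : int -> \bar R) : (forall n, 0 <= G n) ->
  \int[mu]_x (G (Num.ceil x)) = \esum_(n in [set: int]) G n.
Proof.
move=> G0; transitivity (\int[mu]_x
    (if x \in unit_itv (Num.ceil x) then G (Num.ceil x) else 0)).
  by apply: eq_integral => x _; rewrite mem_set//; exact/unit_itvE.
rewrite (@integral_step (@unit_itv R))//;
  [|exact: measurable_unit_itv|by move=> n x].
apply: eq_esum => n _.
by rewrite -[G n in RHS]mule1 -(lebesgue_measure_unit_itv n).
Qed.

Lemma integral_step_half (G : int -> \bar R) : (forall n, 0 <= G n) ->
  \int[mu]_x (if x \in half_itv (Num.ceil x) then G (Num.ceil x) else 0) =
  \esum_(n in [set: int]) (G n * (2^-1)%:E).
Proof.
move=> G0; rewrite integral_step//;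
  [|exact: measurable_half_itv|exact: half_itv_unit].
by apply: eq_esum => n _; rewrite -(lebesgue_measure_half_itv n).
Qed.

Lemma ge0_esumZr (G : int -> \bar R) (c : \bar R) :
  0 <= c -> (forall n, 0 <= G n) ->
  \esum_(n in [set: int]) (G n * c) = (\esum_(n in [set: int]) G n) * c.
Proof.
move=> c0 G0; have Gc0 n : 0 <= G n * c by exact: mule_ge0.
(* Both sums are integrals of step functions, so linearity of the integral
   applies. *)
rewrite -!integral_step_unit// ge0_integralZr//.
apply: measurable_fun_unit_itv => n.
apply: (@eq_measurable_fun _ _ _ _ _ (cst (G n))) => //.
by move=> x /set_mem/unit_itvE /= ->.
Qed.

(** No null set contains [A], so the almost everywhere bound by the essential
    supremum holds at some point of [A]. *)
Lemma ess_sup_ge_on d (T : measurableType d) (m : {measure set T -> \bar R})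
    (A : set T) (g : T -> \bar R) (y : \bar R) :
  measurable A -> 0 < m A -> (forall z, A z -> y <= g z) -> y <= ess_sup m g.
Proof.
move=> mA A0 yg; rewrite leNgt; apply/negP => gy.
have [N [mN N0 gN]] := ess_sup_ge m g.
suff : m A <= m N by rewrite N0 leNgt A0.
apply: le_measure; rewrite ?inE// => z Az; apply: gN => /= gz.
by have := lt_le_trans gy (yg z Az); rewrite ltNge gz.
Qed.

(** Jensen's inequality for powers on a set of measure one: for [p > 1] this is
    Hoelder's inequality against the indicator of [A], whose norm is one. *)
Lemma integral_powR_le (A : set R) (f : R -> R) (p : R) :
  (1 <= p)%R -> measurable A -> mu A = 1 -> measurable_fun setT f ->
  (forall x, 0 <= f x)%R ->
  (\int[mu]_(x in A) (f x)%:E) `^ p <= \int[mu]_(x in A) ((f x)%:E `^ p).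
Proof.
rewrite le_eqVlt => /predU1P[<-|p1] mA A1 mf f0.
  rewrite poweRe1; last by apply: integral_ge0 => x _; rewrite lee_fin.
  by under [leRHS]eq_integral do rewrite poweRe1 ?lee_fin//.
have p0 : (0 < p)%R by exact: lt_trans p1.
pose q := (p / (p - 1))%R.
have q0 : (0 < q)%R by rewrite divr_gt0// subr_gt0.
have pq : (p^-1 + q^-1 = 1)%R.
  by rewrite /q invf_div; field; rewrite !gt_eqF// subr_gt0.
have mfA : measurable_fun setT (f \* \1_A)%R by apply: measurable_funM.
(* Passes between the integrals over the line that appear in Hoelder's
   inequality and integrals over [A]. *)
have restr (g : R -> \bar R) (h : R -> \bar R) :
    (forall x, A x -> g x = h x) -> (forall x, ~ A x -> g x = 0) ->
    \int[mu]_x g x = \int[mu]_(x in A) h x.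
  move=> gh g0; rewrite [RHS]integral_mkcond; apply: eq_integral => x _.
  by rewrite patchE; case: ifPn => [/set_mem/gh//|/negP]; rewrite inE => /g0.
have Nq : 'N[mu]_q%:E [EFin \o \1_A] = 1.
  rewrite unlock (restr _ (cst 1)).
  - rewrite integral_cst// mul1e -[RHS](poweR1r q^-1).
    by congr (_ `^ _); exact: A1.
  - by move=> x Ax /=; rewrite indicE mem_set//= normr1 powR1.
  - by move=> x nAx /=; rewrite indicE memNset//= normr0 powR0 ?gt_eqF.
have := hoelder mu mfA (measurable_indic mA) p0 q0 pq.
rewrite Nq mule1 Lnorm1 (restr _ (EFin \o f)); last 2 first.
- by move=> x Ax /=; rewrite indicE mem_set//= !mulr1 ger0_norm.
- by move=> x nAx /=; rewrite indicE memNset//= !mulr0 normr0.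
set N := Lnorm _ _ _ => fN.
rewrite -(restr (fun x => `|((f \* \1_A) x)%:E| `^ p)
  (fun x => (f x)%:E `^ p)); last 2 first.
- by move=> x Ax /=; rewrite indicE mem_set//= mulr1 ger0_norm.
- by move=> x nAx /=; rewrite indicE memNset//= mulr0 normr0 powR0 ?gt_eqF.
rewrite -poweR_Lnorm ?gt_eqF//.
apply: gt0_ler_poweR => //; first exact: ltW.
- by rewrite in_itv /= leey andbT integral_ge0// => x _; rewrite lee_fin.
- by rewrite in_itv /= leey andbT Lnorm_ge0.
Qed.

End integral_step.

(** * The continuous and the discrete supremum operators *)

Section operators.
Context {R : realType}.
Implicit Types (i j n : int) (x y : R).
Local Notation mu := (@lebesgue_measure R).
Local Open Scope ereal_scope.

Lemma measurable_step_fun (v : int -> R) : measurable_fun setT (step_fun v).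
Proof.
apply: measurable_fun_unit_itv => n.
apply: (@eq_measurable_fun _ _ _ _ _ (cst (v n))) => //.
by move=> x /set_mem/unit_itvE xn; rewrite step_funE xn.
Qed.

Lemma step_fun_ge0 (v : int -> R) : (forall n, 0 <= v n)%R ->
  forall x, (0 <= step_fun v x)%R.
Proof. by move=> v0 x; rewrite step_funE. Qed.

Lemma integral_ray_esum (f : R -> \bar R) i :
  measurable_fun setT f -> (forall x, 0 <= f x) ->
  \int[mu]_(t in `]-oo, i%:~R]) f t =
  \esum_(j in [set j | (j <= i)%R]) \int[mu]_(t in unit_itv j) f t.
Proof.
move=> mf f0; rewrite ge0_integral_unit_itv//; last exact: measurable_funTS.
rewrite [RHS]esum_mkcond; apply: eq_esum => j _.
case: ifPn => [/set_mem /= ji|]; [congr (integral _ _ _)|].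
- apply: setIidr => x; rewrite /unit_itv /= !in_itv /= => /andP[_ xj].
  by rewrite (le_trans xj)// ler_int.
- rewrite notin_setE /= => /negP; rewrite -ltNge => ij.
  rewrite [X in integral _ X](_ : _ = set0) ?integral_set0//.
  rewrite -subset0 => x [] /=; rewrite in_itv /= => xi /unit_itvE xj.
  by move: xi; rewrite -ceil_le_int xj leNgt ij.
Qed.

(** Almost every point for the measure restricted to a half line lies in that
    half line, and [t |-> \int_(-oo, t]] is largest at the right end of each
    unit interval. *)
Lemma sup_op_fun_le (U : int -> int -> R) (f : R -> R) x (M : \bar R) :
  (forall i n, 0 <= U i n)%R ->
  measurable_fun setT f -> (forall x, 0 <= f x)%R ->
  (forall i, (i <= Num.ceil x)%R ->
     (U i (Num.ceil x))%:E *
     (\esum_(j in [set j | (j <= i)%R]) \int[mu]_(t in unit_itv j) (f t)%:E)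
       <= M) ->
  sup_op_fun (step_kernel U) f x <= M.
Proof.
move=> U0 mf f0 UM; apply/ess_supP.
exists `]x, +oo[%classic; split => //.
  rewrite /mrestr -[RHS](measure0 mu); congr (mu _).
  rewrite -subset0 => y [] /=; rewrite !in_itv /= andbT => xy yx.
  by rewrite ltNge yx in xy.
move=> y /=; apply: contra_notP.
rewrite in_itv /= andbT => /negP; rewrite -leNgt => yx.
have := UM (Num.ceil y) (le_ceil yx); apply: le_trans.
rewrite step_kernelE lee_wpmul2l ?lee_fin//.
rewrite -integral_ray_esum//; last exact/measurable_EFinP.
apply: ge0_subset_integral => //.
- by apply/measurable_EFinP; exact: measurable_funTS.
- by move=> t _; rewrite lee_fin.
- by move=> t /=; rewrite !in_itv /= => /le_trans; apply; exact: ceil_ge.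
Qed.

Lemma sup_op_fun_ge0 (U : int -> int -> R) (f : R -> R) x :
  (forall i n, 0 <= U i n)%R -> (forall x, 0 <= f x)%R ->
  0 <= sup_op_fun (step_kernel U) f x.
Proof.
move=> U0 f0; rewrite /sup_op_fun.
apply: (@ess_sup_ge_on R _ (measurableTypeR R) _ `]-oo, x]%classic) => [||y _].
- exact: measurable_itv.
- by rewrite /= /mrestr setIid lebesgue_measure_itv /= ltNyr lt0y.
- rewrite mule_ge0 ?lee_fin ?step_kernelE//.
  by apply: integral_ge0 => t _; rewrite lee_fin.
Qed.

(** By the time the right half of [(i - 1, i]] is reached, the left half has
    already contributed half of the mass of that interval; hence the factor
    two. *)
Lemma esum_le_integral_ray (a : int -> R) i y : (forall n, 0 <= a n)%R ->
  half_itv i y ->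
  \esum_(j in [set j | (j <= i)%R]) (a j)%:E <=
  \int[mu]_(t in `]-oo, y]) (step_fun (fun n => 2 * a n)%R t)%:E.
Proof.
move=> a0; rewrite /half_itv /= in_itv /= => /andP[iy _].
have a20 n : (0 <= 2 * a n)%R by rewrite mulr_ge0.
rewrite ge0_integral_unit_itv//; last 2 first.
- apply/measurable_EFinP; apply: measurable_funTS.
  exact: measurable_step_fun.
- by move=> x _; rewrite lee_fin step_fun_ge0.
rewrite [leLHS]esum_mkcond.
apply: le_esum => j _.
case: ifPn => [/set_mem /= ji|_]; last first.
  by apply: integral_ge0 => x _; rewrite lee_fin step_fun_ge0.
rewrite (eq_integral (cst (2 * a j)%:E)); last first.
  by move=> x /set_mem[_ /unit_itvE xj]; rewrite step_funE xj.
rewrite integral_cst//; last first.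
  by apply: measurableI => //; exact: measurable_unit_itv.
have muh : mu `](j%:~R - 1)%R, (j%:~R - 2^-1)%R]%classic = (2^-1)%:E.
  rewrite lebesgue_measure_itv /= lte_fin. rewrite ifT; last lra.
  by rewrite -EFinB; congr EFin; lra.
rewrite [leLHS](_ : _ =
    (2 * a j)%:E * mu `](j%:~R - 1)%R, (j%:~R - 2^-1)%R]%classic).
  apply: lee_wpmul2l; first by rewrite lee_fin.
  apply: le_measure; rewrite ?inE//.
    by apply: measurableI => //; exact: measurable_unit_itv.
  move=> t /=; rewrite /unit_itv /= !in_itv /= => /andP[jt tj]; split.
  - rewrite (le_trans tj)// ltW// (le_lt_trans _ iy)// lerD2r ler_int//.
  - by rewrite jt (le_trans tj)// gerBl invr_ge0.
by rewrite muh -EFinM mulrAC divff// mul1r.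
Qed.

(** Each competitor [i <= n] of the discrete supremum is reached or exceeded, on
    the continuous side, at all [y] in a set of positive measure below [x]: the
    part of the right half of [(i - 1, i]] that lies below [x]. For [i = n] it
    has positive measure because [x] is itself in the right half of its unit
    interval. *)
Lemma sup_op_seq_le_fun (U : int -> int -> R) (a : int -> R) n x :
  (forall i n, 0 <= U i n)%R -> (forall n, 0 <= a n)%R -> half_itv n x ->
  sup_op_seq U a n <=
  sup_op_fun (step_kernel U) (step_fun (fun n => 2 * a n)%R) x.
Proof.
move=> U0 a0 nx; apply: ge_ereal_sup => _ [i /= le_in <-].
have xn : Num.ceil x = n by exact/unit_itvE/half_itv_unit.
pose A : set (measurableTypeR R) :=
  `](i%:~R - 2^-1)%R, Num.min i%:~R x]%classic.
rewrite /sup_op_fun.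
apply: (@ess_sup_ge_on _ _ _ _ A).
- exact: measurable_itv.
- rewrite /= /mrestr [X in _ < _ X](_ : _ = A); last first.
    apply: setIidl => y; rewrite /A /= !in_itv /= le_min.
    by case/and3P.
  rewrite lebesgue_measure_itv /= lte_fin ifT; last first.
    rewrite lt_min; apply/andP; split; first lra.
    move: nx; rewrite /half_itv /= in_itv /= => /andP[+ _]; apply: le_lt_trans.
    by rewrite lerD2r ler_int.
  rewrite -EFinB lte_fin subr_gt0 lt_min; apply/andP; split; first lra.
  move: nx; rewrite /half_itv /= in_itv /= => /andP[+ _]; apply: le_lt_trans.
  by rewrite lerD2r ler_int.
- move=> y; rewrite /A /= in_itv /= le_min => /and3P[iy yi _].
  have hy : half_itv i y by rewrite /half_itv /= in_itv /= iy yi.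
  have yi' : Num.ceil y = i by exact/unit_itvE/half_itv_unit.
  rewrite step_kernelE xn yi' lee_wpmul2l ?lee_fin//.
  exact: esum_le_integral_ray.
Qed.

Lemma sup_op_seq_ge0 (U : int -> int -> R) (a : int -> R) n :
  (forall i n, 0 <= U i n)%R -> (forall n, 0 <= a n)%R -> 0 <= sup_op_seq U a n.
Proof.
move=> U0 a0; apply: (@le_trans _ _ ((U n n)%:E *
    \esum_(j in [set j : int | (j <= n)%R]) (a j)%:E)).
  by rewrite mule_ge0 ?lee_fin// esum_ge0// => j _; rewrite lee_fin.
by apply: ereal_sup_ubound; exists n => /=.
Qed.

End operators.

(** * Weighted norms of functions and of sequences *)

Section norms.
Context {R : realType}.
Implicit Types (i j n : int) (x y : R).
Local Notation mu := (@lebesgue_measure R).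
Local Open Scope ereal_scope.

Lemma ge0_le_poweR (x y : \bar R) (r : R) :
  (0 <= r)%R -> 0 <= x -> x <= y -> x `^ r <= y `^ r.
Proof.
move=> r0 x0 xy; apply: gt0_ler_poweR => //.
- by rewrite in_itv /= x0 leey.
- by rewrite in_itv /= (le_trans x0 xy) leey.
Qed.

Lemma wnorm_seq_ge0 (r : \bar R) (v : int -> R) (G : int -> \bar R) :
  (forall n, 0 <= v n)%R -> (forall n, 0 <= G n) -> 0 <= wnorm_seq r v G.
Proof.
move=> v0 G0; case: r => [s||] //=; first exact: poweR_ge0.
apply: (@le_trans _ _ ((v 0%R)%:E * G 0%R)); first by rewrite mule_ge0 ?lee_fin.
by apply: ereal_sup_ubound; exists 0%R.
Qed.

Lemma le_wnorm_seq (r : \bar R) (v : int -> R) (G H : int -> \bar R) :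
  0 < r -> (forall n, 0 <= v n)%R -> (forall n, 0 <= G n) ->
  (forall n, G n <= H n) -> wnorm_seq r v G <= wnorm_seq r v H.
Proof.
case: r => [s||] //=; rewrite ?lte_fin => s0 v0 G0 GH.
- apply: ge0_le_poweR; first by rewrite invr_ge0 ltW.
    by apply: esum_ge0 => n _; rewrite mule_ge0 ?lee_fin ?poweR_ge0.
  apply: le_esum => n _; rewrite lee_wpmul2l ?lee_fin//.
  by apply: ge0_le_poweR => //; exact: ltW.
- apply: ge_ereal_sup => _ [n _ <-].
  apply: (@le_trans _ _ ((v n)%:E * H n)).
    by rewrite lee_wpmul2l ?lee_fin.
  by apply: ereal_sup_ubound; exists n.
Qed.

Lemma wnorm_seqZ_le (r : \bar R) (v : int -> R) (G : int -> \bar R) (k : R) :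
  0 < r -> (0 <= k)%R -> (forall n, 0 <= v n)%R -> (forall n, 0 <= G n) ->
  wnorm_seq r v (fun n => k%:E * G n) <= k%:E * wnorm_seq r v G.
Proof.
case: r => [s||] //=; rewrite ?lte_fin => s0 k0 v0 G0.
- have vG0 n : 0 <= (v n)%:E * G n `^ s by rewrite mule_ge0 ?lee_fin ?poweR_ge0.
  rewrite (eq_esum (b := fun n => (v n)%:E * G n `^ s * k%:E `^ s)); last first.
    by move=> n _; rewrite poweRM ?lee_fin// [k%:E `^ s * _]muleC muleA.
  rewrite ge0_esumZr ?poweR_ge0// poweRM ?poweR_ge0//; last exact: esum_ge0.
  by rewrite -poweRrM mulfV ?gt_eqF// poweRe1 ?lee_fin// muleC.
- apply: ge_ereal_sup => _ [n _ <-]; rewrite muleCA lee_wpmul2l ?lee_fin//.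
  by apply: ereal_sup_ubound; exists n.
Qed.

(** Turns a bound on the norm of the operator applied to a test sequence into a
    bound on a single value of the operator. *)
Lemma wnorm_seq_ge_term (r : \bar R) (w : int -> R) n :
  0 < r -> (forall n, 0 <= w n)%R -> (0 < w n)%R ->
  exists2 g : R, (0 < g)%R & forall G : int -> \bar R,
    (forall n, 0 <= G n) -> g%:E * G n <= wnorm_seq r w G.
Proof.
case: r => [s||] //=; rewrite ?lte_fin => s0 w0 wn.
- exists (w n `^ s^-1)%R => [|G G0]; first exact: powR_gt0.
  rewrite -poweR_EFin -[G n]poweRe1// -(@mulfV _ s) ?gt_eqF// poweRrM.
  rewrite -poweRM ?lee_fin ?poweR_ge0//; apply: ge0_le_poweR.
  + by rewrite invr_ge0 ltW.
  + by rewrite mule_ge0 ?lee_fin ?poweR_ge0.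
  + apply: esum_ge; exists [set n]; last by rewrite fsbig_set1.
    by split => //; exact: finite_set1.
- by exists (w n) => // G G0; apply: ereal_sup_ubound; exists n.
Qed.

(** Where the weight vanishes, [F] is free: the points [n] at which the discrete
    operator fails to control the continuous one will have [w n = 0]. *)
Lemma wnorm_fun_le_seq (r : \bar R) (v : int -> R) (F : R -> \bar R)
    (G : int -> \bar R) :
  0 < r -> (forall n, 0 <= v n)%R -> (forall x, 0 <= F x) ->
  (forall n, 0 <= G n) ->
  (forall x, v (Num.ceil x) != 0%R -> F x <= G (Num.ceil x)) ->
  wnorm_fun r (step_fun v) F <= wnorm_seq r v G.
Proof.
case: r => [s||] //=; rewrite ?lte_fin => s0 v0 F0 G0 FG.
- have vG0 n : 0 <= (v n)%:E * G n `^ s by rewrite mule_ge0 ?lee_fin ?poweR_ge0.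
  have vF0 x : 0 <= (step_fun v x)%:E * F x `^ s.
    by rewrite mule_ge0 ?poweR_ge0 ?lee_fin ?step_fun_ge0.
  apply: ge0_le_poweR; first by rewrite invr_ge0 ltW.
    exact: integral_ge0.
  rewrite -integral_step_unit//; apply: ge0_le_integralT => // x.
  rewrite step_funE; have [->|vx] := eqVneq (v (Num.ceil x)) 0%R.
    by rewrite !mul0e.
  by rewrite lee_wpmul2l ?lee_fin// ge0_le_poweR ?FG// ltW.
- apply/ess_supP; apply: nearW => x; rewrite step_funE.
  apply: (@le_trans _ _ ((v (Num.ceil x))%:E * G (Num.ceil x))); last first.
    by apply: ereal_sup_ubound; exists (Num.ceil x).
  have [->|vx] := eqVneq (v (Num.ceil x)) 0%R; first by rewrite !mul0e.
  by rewrite lee_wpmul2l ?lee_fin// FG.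
Qed.

(** The price, in the weighted norm of exponent [r], of knowing a lower bound
    on the right half of each unit interval only. *)
Definition half_mass_cst (r : \bar R) : R :=
  if r is s%:E then 2 `^ s^-1 else 1.

Lemma half_mass_cst_gt0 (r : \bar R) : (0 < half_mass_cst r)%R.
Proof. by case: r => //= s; rewrite powR_gt0. Qed.

Lemma wnorm_seq_le_fun (r : \bar R) (w : int -> R) (F : R -> \bar R)
    (G : int -> \bar R) :
  0 < r -> (forall n, 0 <= w n)%R -> (forall x, 0 <= F x) ->
  (forall n, 0 <= G n) -> (forall n x, half_itv n x -> G n <= F x) ->
  wnorm_seq r w G <= (half_mass_cst r)%:E * wnorm_fun r (step_fun w) F.
Proof.
case: r => [s||] //=; rewrite ?lte_fin => s0 w0 F0 G0 GF.
- have wG0 n : 0 <= (w n)%:E * G n `^ s by rewrite mule_ge0 ?lee_fin ?poweR_ge0.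
  have wF0 x : 0 <= (step_fun w x)%:E * F x `^ s.
    by rewrite mule_ge0 ?poweR_ge0 ?lee_fin ?step_fun_ge0.
  rewrite -poweR_EFin -poweRM ?lee_fin//; last exact: integral_ge0.
  apply: ge0_le_poweR; [by rewrite invr_ge0 ltW|exact: esum_ge0|].
  rewrite [leLHS](_ : _ =
      2%:E * \esum_(n in [set: int]) ((w n)%:E * G n `^ s * (2^-1)%:E)).
    rewrite lee_wpmul2l ?lee_fin// -integral_step_half//.
    apply: ge0_le_integralT => [x|x]; first by case: ifP.
    case: ifPn => [/set_mem hx|//]; rewrite step_funE lee_wpmul2l ?lee_fin//.
    by rewrite ge0_le_poweR ?(GF _ _ hx)// ltW.
  rewrite ge0_esumZr ?lee_fin// muleCA -EFinM divff// mule1//.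
- rewrite mul1e; apply: ge_ereal_sup => _ [n _ <-].
  apply: (@ess_sup_ge_on R _ (measurableTypeR R) _ (half_itv n)) => [||x nx].
  + exact: measurable_half_itv.
  + by rewrite [ltRHS]lebesgue_measure_half_itv lte_fin.
  + have /unit_itvE xn := half_itv_unit nx.
    by rewrite step_funE xn lee_wpmul2l ?lee_fin// GF.
Qed.

(** Replacing a function by its means over the unit intervals does not increase
    the norm with a step weight: this is Jensen's inequality on each interval,
    and is where [1 <= p] enters. *)
Lemma wnorm_seq_mean_le (p : \bar R) (v : int -> R) (f : R -> R) :
  1 <= p -> (forall n, 0 <= v n)%R ->
  measurable_fun setT f -> (forall x, 0 <= f x)%R ->
  wnorm_seq p v (fun n => \int[mu]_(t in unit_itv n) (f t)%:E) <=
  wnorm_fun p (step_fun v) (EFin \o f).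
Proof.
case: p => [s||] //=; rewrite ?lee_fin => s1 v0 mf f0.
- have s0 : (0 < s)%R by exact: lt_le_trans s1.
  have mfs (D : set R) : measurable_fun D (fun x => (f x)%:E `^ s).
    under eq_fun do rewrite poweR_EFin.
    apply/measurable_EFinP.
    apply: (measurableT_comp (f := @powR R ^~ s)) => //.
    exact: measurable_funTS.
  apply: ge0_le_poweR; first by rewrite invr_ge0 ltW.
    by apply: esum_ge0 => n _; rewrite mule_ge0 ?lee_fin ?poweR_ge0.
  rewrite ge0_integral_unit_itv//; last 2 first.
  + apply: emeasurable_funM; last exact: mfs.
    by apply/measurable_EFinP; exact: measurable_step_fun.
  + by move=> x _; rewrite mule_ge0 ?lee_fin ?powR_ge0 ?step_fun_ge0.
  apply: le_esum => n _; rewrite setTI.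
  rewrite [leRHS](_ : _ =
      \int[mu]_(x in unit_itv n) ((v n)%:E * (f x)%:E `^ s)); last first.
    by apply: eq_integral => x /set_mem/unit_itvE xn; rewrite step_funE xn.
  rewrite ge0_integralZl; last 4 first.
  + exact: measurable_unit_itv.
  + exact: mfs.
  + by move=> x _; exact: poweR_ge0.
  + by rewrite lee_fin.
  rewrite lee_wpmul2l ?lee_fin//; apply: integral_powR_le => //.
    exact: measurable_unit_itv.
  exact: lebesgue_measure_unit_itv.
- apply: ge_ereal_sup => _ [n _ <-]; set M := ess_sup _ _.
  have M0 : 0 <= M.
    apply: (@ess_sup_ge_on R _ (measurableTypeR R) _ (unit_itv 0)) => [||x _].
    + exact: measurable_unit_itv.
    + by rewrite [ltRHS]lebesgue_measure_unit_itv.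
    + by rewrite mule_ge0 ?lee_fin ?step_fun_ge0.
  have mfn : measurable_fun (unit_itv n) (EFin \o f).
    by apply/measurable_EFinP; exact: measurable_funTS.
  rewrite -ge0_integralZl//; last 3 first.
  + exact: measurable_unit_itv.
  + by move=> x _; rewrite lee_fin.
  + by rewrite lee_fin.
  rewrite [leRHS](_ : _ = \int[mu]_(x in unit_itv n) cst M x); last first.
    rewrite integral_cst; last exact: measurable_unit_itv.
    rewrite -[LHS]mule1; congr (_ * _); exact/esym/lebesgue_measure_unit_itv.
  apply: ae_ge0_le_integral => //.
  + exact: measurable_unit_itv.
  + by move=> x _; rewrite mule_ge0 ?lee_fin.
  + by apply: emeasurable_funM.
  + have := ess_sup_ge mu (fun x => (step_fun v x)%:E * (EFin \o f) x).
    apply: filterS => x xM /unit_itvE xn.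
    by move: xM; rewrite step_funE xn.
Qed.

End norms.

(** * Transfer of the inequalities *)

Section comparison.
Context {R : realType}.
Implicit Types (i j m n : int) (x y : R).
Local Notation mu := (@lebesgue_measure R).
Local Open Scope ereal_scope.

(** An infinite entry [A m] lies above all multiples of the unit sequence at
    [m], so the discrete inequality bounds the operator on all these multiples
    by the same finite number. *)
Lemma discrete_ineq_kernel0 (p q : \bar R) (U : int -> int -> R)
    (v w : int -> R) (C : R) (A : int -> \bar R) m n :
  0 < p -> 0 < q -> (forall i n, 0 <= U i n)%R ->
  (forall n, 0 <= v n)%R -> (forall n, 0 <= w n)%R -> (0 <= C)%R ->
  discrete_ineq p q U v w C ->
  (forall n, 0 <= A n) -> C%:E * wnorm_seq p v A < +oo ->
  A m = +oo -> (m <= n)%R -> w n != 0%R -> U m n = 0%R.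
Proof.
move=> p0 q0 U0 v0 w0 C0 D A0 Afin Am mn wn.
apply/eqP; rewrite eq_le U0 andbT leNgt; apply/negP => Umn.
have wn0 : (0 < w n)%R by rewrite lt_neqAle eq_sym wn w0.
have [g g0 gle] := wnorm_seq_ge_term q0 w0 wn0.
have bfin : C%:E * wnorm_seq p v A \is a fin_num.
  by rewrite ge0_fin_numE// mule_ge0 ?lee_fin// wnorm_seq_ge0.
set b := fine (C%:E * wnorm_seq p v A).
have b0 : (0 <= b)%R.
  by rewrite -lee_fin fineK// mule_ge0 ?lee_fin// wnorm_seq_ge0.
(* Chosen so that the entry of the operator at [n], weighted by [g], would be
   [b + 1], above the bound [b]. *)
pose k := ((b + 1) / (g * U m n))%R.
have k0 : (0 <= k)%R by rewrite divr_ge0 ?addr_ge0// mulr_ge0// ltW.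
pose e := fun j : int => if j == m then k else 0%R.
have e0 j : (0 <= e j)%R by rewrite /e; case: ifP.
suff : (b + 1)%:E <= b%:E by rewrite lee_fin; lra.
have -> : (b + 1)%:E = g%:E * ((U m n)%:E * k%:E).
  rewrite -!EFinM /k; congr EFin; rewrite mulrA mulrC divfK//.
  by rewrite mulf_neq0 ?gt_eqF.
rewrite [leRHS]fineK//.
apply: (@le_trans _ _ (g%:E * sup_op_seq U e n)).
  apply: lee_wpmul2l; first by rewrite lee_fin ltW.
  apply: (@le_trans _ _ ((U m n)%:E *
      \esum_(j in [set j : int | (j <= m)%R]) (e j)%:E)); last first.
    by apply: ereal_sup_ubound; exists m.
  rewrite lee_wpmul2l ?lee_fin//; apply: esum_ge; exists [set m].
    by split; [exact: finite_set1|move=> j ->/=].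
  by rewrite fsbig_set1 /e eqxx.
apply: (le_trans (gle _ _)); first by move=> j; exact: sup_op_seq_ge0.
apply: (le_trans (D e e0)); rewrite lee_wpmul2l ?lee_fin//.
apply: le_wnorm_seq => // j; rewrite /= /e.
by case: eqP => [->|_]; [rewrite Am leey|exact: A0].
Qed.

Lemma continuous_ineq_of_discrete (p q : \bar R) (c : R)
    (U : int -> int -> R) (v w : int -> R) (C : R) :
  1 <= p -> 0 < q -> regular_kernel c U ->
  (forall n, 0 <= v n)%R -> (forall n, 0 <= w n)%R -> (0 <= C)%R ->
  discrete_ineq p q U v w C ->
  continuous_ineq p q (step_kernel U) (step_fun v) (step_fun w) C.
Proof.
move=> p1 q0 [_ U0 Udec _ _] v0 w0 C0 D f mf f0.
have p0 : 0 < p by exact: lt_le_trans p1.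
pose A n := \int[mu]_(t in unit_itv n) (f t)%:E.
have A0 n : 0 <= A n by apply: integral_ge0 => x _; rewrite lee_fin.
have CA : C%:E * wnorm_seq p v A <=
    C%:E * wnorm_fun p (step_fun v) (EFin \o f).
  by rewrite lee_wpmul2l ?lee_fin//; exact: wnorm_seq_mean_le.
have [->|] := eqVneq (C%:E * wnorm_fun p (step_fun v) (EFin \o f)) +oo.
  by rewrite leey.
rewrite -ltey => /(le_lt_trans CA) Afin.
(* [fine] sends the infinite entries to zero. *)
pose a n := fine (A n).
have a0 n : (0 <= a n)%R by rewrite fine_ge0.
apply: (le_trans _ CA).
apply: (@le_trans _ _ (C%:E * wnorm_seq p v (EFin \o a))).
  apply: (le_trans _ (D a a0)); apply: wnorm_fun_le_seq => // [x|n|x wx].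
  - exact: sup_op_fun_ge0.
  - exact: sup_op_seq_ge0.
  - apply: sup_op_fun_le => // i ix; set n := Num.ceil x in ix wx *.
    (* If the term [i] sees an infinite entry [A m], then [U i n <= U m n = 0];
       otherwise passing from [A] to [a] leaves its sum unchanged. *)
    have [[m /= mi Am]|finA] := pselect (exists2 m, (m <= i)%R & A m = +oo).
      have Umn := discrete_ineq_kernel0 p0 q0 U0 v0 w0 C0 D A0 Afin Am
        (le_trans mi ix) wx.
      have -> : U i n = 0%R.
        by apply/eqP; rewrite eq_le U0 andbT -Umn Udec.
      by rewrite mul0e sup_op_seq_ge0.
    rewrite (eq_esum (b := fun j => (a j)%:E)); last first.
      move=> j /= ji; rewrite /a fineK// ge0_fin_numE// ltey.
      by apply/eqP => Aj; apply: finA; exists j.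
    by apply: ereal_sup_ubound; exists i.
rewrite lee_wpmul2l ?lee_fin//; apply: le_wnorm_seq => // n /=.
by rewrite /a; have := A0 n; case: (A n) => //= _; rewrite leey.
Qed.

Lemma discrete_ineq_of_continuous (p q : \bar R) (U : int -> int -> R)
    (v w : int -> R) (C : R) :
  0 < p -> 0 < q -> (forall i n, 0 <= U i n)%R ->
  (forall n, 0 <= v n)%R -> (forall n, 0 <= w n)%R -> (0 <= C)%R ->
  continuous_ineq p q (step_kernel U) (step_fun v) (step_fun w) C ->
  discrete_ineq p q U v w (2 * half_mass_cst q * C).
Proof.
move=> p0 q0 U0 v0 w0 C0 I a a0.
pose f := step_fun (fun n => 2 * a n)%R.
have a20 n : (0 <= 2 * a n)%R by rewrite mulr_ge0.
have f0 x : (0 <= f x)%R by exact: step_fun_ge0.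
apply: (@le_trans _ _ ((half_mass_cst q)%:E *
    wnorm_fun q (step_fun w) (sup_op_fun (step_kernel U) f))).
  apply: wnorm_seq_le_fun => // [x|n|n x nx].
  - exact: sup_op_fun_ge0.
  - exact: sup_op_seq_ge0.
  - exact: sup_op_seq_le_fun.
rewrite -mulrA EFinM [2%:E * _]muleC EFinM -!muleA.
apply: lee_wpmul2l; first by rewrite lee_fin ltW// half_mass_cst_gt0.
apply: (le_trans (I f (measurable_step_fun _) f0)).
rewrite lee_wpmul2l ?lee_fin//.
have := @wnorm_seqZ_le _ p v (EFin \o a) 2%R p0 (ler0n _ _) v0 (fun n => a0 n).
apply: le_trans; apply: wnorm_fun_le_seq => // x _.
by rewrite /= /f step_funE.
Qed.

End comparison.

Local Open Scope ring_scope.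

Theorem theorem3p5 (R : realType) (p q : \bar R) (c : R) :
  (1 <= p)%E -> (0 < q)%E -> 0 < c ->
  exists c1 c2 : R, [/\ 0 < c1, 0 < c2 &
    forall (U : int -> int -> R) (v w : int -> R),
      regular_kernel c U ->
      (forall n, 0 <= v n) -> (forall n, 0 <= w n) ->
      let D := discrete_ineq p q U v w in
      let I := continuous_ineq p q (step_kernel U) (step_fun v) (step_fun w) in
      ((exists C : R, 0 <= C /\ D C) <-> (exists C1 : R, 0 <= C1 /\ I C1)) /\
      (c1%:E * best_constant D <= best_constant I)%E /\
      (best_constant I <= c2%:E * best_constant D)%E].
Proof.
move=> p1 q0 _; have p0 : (0 < p)%E by exact: lt_le_trans p1.
pose K := 2 * half_mass_cst q.
have K0 : 0 < K by rewrite mulr_gt0// half_mass_cst_gt0.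
exists K^-1, 1; split; rewrite ?invr_gt0// => U v w regU v0 w0 D I.
have U0 := regular_kernel_ge0 regU.
have DI C : 0 <= C -> D C -> I C.
  by move=> C0; exact: (continuous_ineq_of_discrete p1 q0 regU).
have ID C : 0 <= C -> I C -> D (K * C).
  by move=> C0; exact: (discrete_ineq_of_continuous p0 q0 U0).
have KC0 C : 0 <= C -> 0 <= K * C by move=> C0; rewrite mulr_ge0// ltW.
split; [split => -[C [C0 h]]|split].
- by exists C; split => //; exact: DI.
- by exists (K * C); split; [exact: KC0|exact: ID].
- apply/ereal_infP => _ [C [C0 IC] <-].
  rewrite lee_pdivrMl//; apply: ereal_inf_lbound.
  by exists (K * C); [split; [exact: KC0|exact: ID]|].
- rewrite mul1e; apply/ereal_infP => _ [C [C0 DC] <-].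
  by apply: ereal_inf_lbound; exists C => //; split => //; exact: DI.
Qed.
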